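(* Let $\mathcal{B}_1$ be the arrangement consisting of $n_1$ lines passing through a point $a_1\in\mathbb{P}^2$, and let $\mathcal{B}_2$ be the arrangement consisting of $n_2$ lines passing through a point $a_2\in\mathbb{P}^2\setminus\mathcal{B}_1$ (that is, $a_2$ lies on no line of $\mathcal{B}_1$), such that $1\leq n_1\leq n_2$ and $n_1+n_2>2$. Then the arrangement $\mathcal{A}'=\mathcal{B}_1\cup\mathcal{B}_2$ has type $0$ and exponents $(1,n_1+n_2-2)$ for $n_1=1$, and type $1$ and exponents $(n_1,n_2,n_1+n_2-2)$ for $n_1\geq 2$.
   Context: A line arrangement is a finite set of distinct lines in $\mathbb{P}^2=\mathbb{P}^2_{\mathbb{C}}$, identified with the reduced curve given by their union. Let $S=\mathbb{C}[x,y,z]$ with its standard grading. For a reduced curve $C:f=0$ of degree $d$ in $\mathbb{P}^2$, let $$D_0(f)=\{(a,b,c)\in S^3 : af_x+bf_y+cf_z=0\}$$ be the graded $S$-module of Jacobian syzygies, where a homogeneous element $(a,b,c)$ has degree $k$ if $a,b,c$ are homogeneous of degree $k$. Let $d_1\leq d_2\leq\dots\leq d_m$ be the degrees of the elements of a minimal system of homogeneous generators of $D_0(f)$; $(d_1,\dots,d_m)$ are the exponents of $C$. The type of $C$ is $t(C)=d_1+d_2+1-d$.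
   Formalization: For n_1 ≥ 2 it is additionally assumed that a_1 lies on no line of B_2; otherwise the line a_1a_2 is in B_2 and A' is free with exponents n_1 and n_2−1, e.g. xz(y²−z²)=0 with n_1=n_2=2 has the degree-1 syzygy (3x,−y,−z). *)

(* Defs.v *)
From HB Require Import structures.
From mathcomp Require Import all_boot all_order all_algebra.
From mathcomp Require Import finmap reals complex mpoly.

Set Implicit Arguments.
Unset Strict Implicit.
Unset Printing Implicit Defensive.

Import Order.TTheory GRing.Theory Num.Theory.

Local Open Scope ring_scope.

(* Points and lines of the projective plane over K are the 1- and
   2-dimensional linear subspaces of K^3. *)
Definition projective_point (K : fieldType) :=
  {U : {vspace 'rV[K]_3} | \dim U == 1%N}.
Definition projective_line (K : fieldType) :=
  {U : {vspace 'rV[K]_3} | \dim U == 2%N}.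
HB.instance Definition _ (K : fieldType) := Choice.on (projective_point K).
HB.instance Definition _ (K : fieldType) := Choice.on (projective_line K).

Definition on_line (K : fieldType) (a : projective_point K)
    (L : projective_line K) : bool :=
  (val a <= val L)%VS.

Definition line_equation (K : fieldType) (L : projective_line K)
    (l : {mpoly K[3]}) :=
  l \is 1.-homog /\
  forall v : 'rV[K]_3, (v \in val L) = (l.@[fun i => v ord0 i] == 0).

(* The lines of A being distinct, the product below is the reduced equation of
   their union; it is determined by A up to a nonzero scalar. *)
Definition arrangement_equation (K : fieldType) (A : {fset projective_line K})
    (f : {mpoly K[3]}) :=
  exists l : projective_line K -> {mpoly K[3]},
    (forall L : projective_line K, L \in A -> line_equation L (l L)) /\
    f = \prod_(L <- A) l L.

Section Syzygies.

Variables (K : fieldType) (f : {mpoly K[3]}).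

Definition jacobian_syzygy (v : 'rV[{mpoly K[3]}]_3) :=
  \sum_i v ord0 i * f^`M(i) = 0.

Definition homogeneous (k : nat) (v : 'rV[{mpoly K[3]}]_3) :=
  forall i, v ord0 i \is k.-homog.

Definition minimal_generators (m : nat) (g : 'I_m -> 'rV[{mpoly K[3]}]_3) :=
  [/\ forall j, jacobian_syzygy (g j),
      forall v, jacobian_syzygy v ->
        exists c : 'I_m -> {mpoly K[3]}, v = \sum_j c j *: g j
    & forall j, ~ exists c : 'I_m -> {mpoly K[3]},
        g j = \sum_(k | k != j) c k *: g k].

(* The degrees of a minimal homogeneous system of generators do not depend on
   the system (graded Nakayama lemma), so that e is unique. *)
Definition exponents (e : seq nat) :=
  sorted leq e /\
  exists g : 'I_(size e) -> 'rV[{mpoly K[3]}]_3,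
    minimal_generators g /\
    forall j : 'I_(size e), homogeneous (nth 0%N e j) (g j).

(* (msize f).-1 is the degree of f; the type is an integer since the
   subtraction on nat is truncated. *)
Definition curve_type (t : int) :=
  exists d1 d2 : nat, exists e : seq nat,
    exponents [:: d1, d2 & e] /\
    t = d1%:Z + d2%:Z + 1 - ((msize f).-1)%:Z.

End Syzygies.

(* Main.v *)
Require Import Defs.
From HB Require Import structures.
From mathcomp Require Import all_boot all_order all_algebra.
From mathcomp Require Import finmap reals complex mpoly ring zify.

Set Implicit Arguments.
Unset Strict Implicit.
Unset Printing Implicit Defensive.

Import Order.TTheory GRing.Theory Num.Theory.

Local Open Scope ring_scope.

(** Let g and h be the products of the linear forms of the two pencils, of
    degrees n1 and n2, and f = g h. Choose a basis ex, ey, ez of K^3 with ex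
    on a1 and ey on a2, and let x, y, z be the dual coordinates: then g is a
    form in y and z alone, and h a form in x and z alone. A Jacobian syzygy is
    a derivation theta that kills f. Three of them are visible:
      (n1 + n2) g d/dy - g_y E,   (n1 + n2) h d/dx - h_x E   and
      g_y h_z d/dx + g_z h_x d/dy - g_y h_x d/dz,
    E being the Euler derivation; their degrees are n1, n2 and n1 + n2 - 2.

    Conversely, if theta kills f then each line l of the arrangement divides
    theta(l), because l is prime and the other lines are not multiples of l.
    The linear forms of a pencil are combinations of two coordinates, so by
    Cramer's rule h divides z theta(x) - x theta(z), and g divides
    z theta(y) - y theta(z) ([wedge0_divides], [wedge1_divides]). The two
    quotients q2 and q1 determine theta ([wedge_inj]): the equation
    theta(f) = 0 gives theta(z), and then theta(x) and theta(y) follow. They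
    also satisfy a congruence modulo z ([wedge_congruence]). Modulo z both
    g and h become nonzero constants times powers of y and of x, and solving
    the congruence there shows that (q1, q2) is a combination of (z, 0),
    (0, z) and (n1 h_x, n2 g_y), which are, up to a constant, the pairs
    of the three syzygies above ([congruence_solution]).

    For n1, n2 >= 2 all coefficients of a relation among the three generators
    vanish at the origin ([relation_eval0]), which is minimality. For n1 = 1
    the vectors ex and ez are taken on the line of the first pencil, so that
    g is a multiple of y; then the first and the third syzygy already form a
    basis of the module of syzygies. *)

(** * Linear forms are prime *)

Section LinearForms.
Variables (K : fieldType) (n : nat).
Implicit Types (p q r : {mpoly K[n]}) (c e : 'rV[K]_n).

Definition divides p q := exists r, q = r * p.

Lemma divides_mull p q r : divides p q -> divides p (r * q).
Proof. by case=> s ->; exists (r * s); rewrite mulrA. Qed.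

Lemma dividesD p q r : divides p q -> divides p r -> divides p (q + r).
Proof. by case=> s -> [t ->]; exists (s + t); rewrite mulrDl. Qed.

Lemma divides_refl p : divides p p.
Proof. by exists 1; rewrite mul1r. Qed.

Lemma divides0 p : divides p 0.
Proof. by exists 0; rewrite mul0r. Qed.

Definition dot c e := \sum_i c 0 i * e 0 i.

Definition linear_form c : {mpoly K[n]} := \sum_i c 0 i *: 'X_i.

Lemma linear_form_eval c e : (linear_form c).@[fun i => e 0 i] = dot c e.
Proof.
by rewrite raddf_sum; apply: eq_bigr => i _; rewrite /= mevalZ mevalXU.
Qed.

Definition linear_coeffs p : 'rV[K]_n := \row_i p@_(U_(i)).

Lemma homog1_linear_form p : p \is 1.-homog -> p = linear_form (linear_coeffs p).
Proof.
move=> hp; apply/mpolyP => m; rewrite /linear_form raddf_sum /=.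
case: (boolP (mdeg m == 1%N)) => [|m1]; last first.
  rewrite (dhomog_nemf_coeff hp) // big1 // => i _.
  rewrite mcoeffZ mcoeffX; case: eqP => [mE|]; last by rewrite mulr0.
  by rewrite -mE mdeg1 eqxx in m1.
rewrite mdeg_eq1 => /existsP[i /eqP->]; rewrite (bigD1 i) //= mcoeffZ mcoeffX eqxx mulr1.
rewrite mxE big1 ?addr0 // => j ji; rewrite mcoeffZ mcoeffX.
by rewrite eq_mnm1 (negbTE ji) mulr0.
Qed.

(** Restriction to the hyperplane c = 0, read back on the whole space through
    the projection along e; it is a ring morphism with kernel (c) as soon as
    c takes the value 1 at e. *)
Definition proj_along c e p : {mpoly K[n]} :=
  p \mPo [tuple 'X_i - e 0 i *: linear_form c | i < n].

Lemma proj_alongM c e p q :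
  proj_along c e (p * q) = proj_along c e p * proj_along c e q.
Proof. exact: rmorphM. Qed.

Lemma proj_along_form c e c' :
  proj_along c e (linear_form c') =
  linear_form c' - dot c' e *: linear_form c.
Proof.
rewrite /proj_along {1}/linear_form raddf_sum /= /dot scaler_suml -sumrB.
apply: eq_bigr => i _.
by rewrite comp_mpolyZ comp_mpolyXU -tnth_nth tnth_mktuple scalerBr scalerA.
Qed.

(** The polynomials that agree with their projection modulo c form a subring,
    which contains the constants and the variables. *)
Lemma proj_along_mod c e p : divides (linear_form c) (p - proj_along c e p).
Proof.
set l := linear_form c.
have divM q r : divides l (q - proj_along c e q) ->
  divides l (r - proj_along c e r) -> divides l (q * r - proj_along c e (q * r)).
  move=> dq dr; rewrite proj_alongM.
  rewrite (_ : _ - _ = r * (q - proj_along c e q)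
     + proj_along c e q * (r - proj_along c e r)); last by ring.
  by apply: dividesD; apply: divides_mull.
elim/mpolyind: p => [|a m p _ _ IH].
  by rewrite /proj_along raddf0 subr0; apply: divides0.
rewrite /proj_along raddfD opprD addrACA; apply: dividesD => //.
rewrite /= comp_mpolyZ -scalerBr -mul_mpolyC; apply: divides_mull.
rewrite mpolyXE_id; elim/big_ind: _ => [||i _]; last first.
- elim: (m i) => [|k IHk].
    by rewrite expr0 [_ \mPo _]rmorph1 subrr; apply: divides0.
  rewrite exprS; apply: divM => //.
  rewrite /proj_along comp_mpolyXU -tnth_nth tnth_mktuple opprB addrC subrK.
  by rewrite -mul_mpolyC; apply: divides_mull; apply: divides_refl.
- exact: divM.
- by rewrite [_ \mPo _]rmorph1 subrr; apply: divides0.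
Qed.

Lemma proj_along_eq0 c e p : dot c e = 1 ->
  divides (linear_form c) p <-> proj_along c e p = 0.
Proof.
move=> ce1; split=> [[r ->]|p0].
  by rewrite proj_alongM proj_along_form ce1 scale1r subrr mulr0.
by have := proj_along_mod c e p; rewrite p0 subr0.
Qed.

Lemma exists_dual c : c != 0 -> exists e, dot c e = 1.
Proof.
case/rV0Pn => i ci; exists (\row_j ((j == i)%:R / c 0 i)).
rewrite /dot (bigD1 i) //= mxE eqxx mul1r divff // big1 ?addr0 // => j /negbTE ji.
by rewrite mxE ji mul0r mulr0.
Qed.

(** The ideal of a nonzero linear form is the kernel of a ring morphism into an
    integral domain. *)
Lemma linear_form_prime c p q : c != 0 ->
  divides (linear_form c) (p * q) ->
  divides (linear_form c) p \/ divides (linear_form c) q.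
Proof.
case/exists_dual => e ce1; rewrite !(proj_along_eq0 _ ce1) proj_alongM.
by move/eqP; rewrite mulf_eq0 => /orP[] /eqP; [left|right].
Qed.

Lemma not_divides1 c : c != 0 -> ~ divides (linear_form c) 1.
Proof.
case/exists_dual => e ce1 /(proj_along_eq0 _ ce1)/eqP.
by rewrite [proj_along _ _ _]rmorph1 oner_eq0.
Qed.

Lemma linear_form_eq0 c : (linear_form c == 0) = (c == 0).
Proof.
apply/eqP/eqP => [l0|->]; last first.
  by rewrite /linear_form big1 // => i _; rewrite mxE scale0r.
case: (eqVneq c 0) => // /exists_dual[e].
rewrite -linear_form_eval l0 meval0 => /esym/eqP.
by rewrite oner_eq0.
Qed.

End LinearForms.

(** * Products of distinct lines *)

Section Products.
Variables (K : fieldType) (n : nat) (I : eqType) (c : I -> 'rV[K]_n).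
Implicit Types (p : {mpoly K[n]}) (s : seq I).
Local Notation l i := (linear_form (c i)).

Definition distinct_forms s := uniq s /\
  {in s &, forall i j, i != j -> ~ divides (l i) (l j)}.

Lemma not_divides_prod a s : c a != 0 ->
  {in s, forall j, ~ divides (l a) (l j)} -> ~ divides (l a) (\prod_(i <- s) l i).
Proof.
move=> a0; elim: s => [|b s IH] as_ /=.
  by rewrite big_nil; apply: not_divides1.
rewrite big_cons => /(linear_form_prime a0)[]; first by apply: as_; rewrite mem_head.
by apply: IH => j js; apply: as_; rewrite inE js orbT.
Qed.

(** Pairwise non-associated primes that divide p divide it jointly. *)
Lemma prod_linear_forms_divides s p : {in s, forall i, c i != 0} ->
  distinct_forms s -> {in s, forall i, divides (l i) p} ->
  divides (\prod_(i <- s) l i) p.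
Proof.
elim: s => [|a s IH] s0 [us ds] sp; first by exists p; rewrite big_nil mulr1.
have [/= /andP[a_s us'] ass] := (us, fun x => @mem_behead _ (a :: s) x).
move: IH; case=> [i /ass /s0|||r pE] //.
- by split=> // i j /ass si /ass; apply: ds.
- by move=> i /ass /sp.
have : divides (l a) (r * \prod_(i <- s) l i).
  by rewrite -pE; apply: sp; apply: mem_head.
case/(linear_form_prime (s0 a (mem_head _ _))) => [[t rE]|].
  by exists t; rewrite big_cons mulrA -rE.
case/not_divides_prod; first by apply: s0; apply: mem_head.
move=> j js; apply: ds; rewrite ?mem_head ?ass //.
by apply: contraNneq a_s => ->.
Qed.

End Products.

(** * Derivations of the polynomial ring *)

Section Derivations.
Variables (K : fieldType) (n : nat).
Implicit Types (p q r : {mpoly K[n]}) (c e : 'rV[K]_n) (v : 'rV[{mpoly K[n]}]_n).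

(** The vector field v acting on p: a Jacobian syzygy of f is a field v with
    der v f = 0. *)
Definition der v p := \sum_i v 0 i * p^`M(i).

Lemma derM v p q : der v (p * q) = der v p * q + p * der v q.
Proof.
rewrite /der mulr_suml mulr_sumr -big_split; apply: eq_bigr => i _.
rewrite mderivM /=; ring.
Qed.

Lemma derD v p q : der v (p + q) = der v p + der v q.
Proof.
by rewrite /der -big_split; apply: eq_bigr => i _; rewrite mderivD mulrDr.
Qed.

Lemma derC v a : der v a%:MP = 0.
Proof. by rewrite /der big1 // => i _; rewrite mderivC mulr0. Qed.

Lemma derZ v a p : der v (a *: p) = a *: der v p.
Proof. by rewrite -mul_mpolyC derM derC mul0r add0r mul_mpolyC. Qed.

Lemma der_addl u v p : der (u + v) p = der u p + der v p.
Proof.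
by rewrite /der -big_split; apply: eq_bigr => i _; rewrite mxE mulrDl.
Qed.

Lemma der_scalel q v p : der (q *: v) p = q * der v p.
Proof.
by rewrite /der mulr_sumr; apply: eq_bigr => i _; rewrite mxE mulrA.
Qed.

Lemma der0l p : der 0 p = 0.
Proof. by rewrite /der big1 // => i _; rewrite mxE mul0r. Qed.

Lemma der_oppl v p : der (- v) p = - der v p.
Proof. by rewrite -scaleN1r der_scalel mulN1r. Qed.

Lemma der_form v c : der v (linear_form c) = \sum_i c 0 i *: v 0 i.
Proof.
rewrite /linear_form (big_morph _ (derD v) (_ : der v 0 = 0)); last first.
  by rewrite -mpolyC0 derC.
apply: eq_bigr => i _; rewrite derZ; congr (_ *: _).
rewrite /der (bigD1 i) //= mderivX mnm1E eqxx.
rewrite (_ : U_(i) - U_(i) = 0)%MM; last by apply/mnmP => j; rewrite !mnmE subnn.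
rewrite mpolyX0 scale1r mulr1 big1 ?addr0 // => j ji.
by rewrite mderivX mnm1E eq_sym (negbTE ji) scale0r mulr0.
Qed.

Lemma der_exp v p k : der v (p ^+ k.+1) = k.+1%:R * p ^+ k * der v p.
Proof.
elim: k => [|k IH]; first by rewrite expr1 expr0 !mul1r.
by rewrite exprS derM {}IH -(natr1 k.+1); rewrite (exprS p k); ring.
Qed.

Definition const_field e : 'rV[{mpoly K[n]}]_n := \row_i (e 0 i)%:MP.
Definition euler : 'rV[{mpoly K[n]}]_n := \row_i 'X_i.

Lemma der_const_form e c :
  der (const_field e) (linear_form c) = (dot c e)%:MP.
Proof.
rewrite der_form /dot raddf_sum /=; apply: eq_bigr => i _.
by rewrite mxE -mul_mpolyC -mpolyCM.
Qed.

Lemma der_euler_form c : der euler (linear_form c) = linear_form c.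
Proof. by rewrite der_form; apply: eq_bigr => i _; rewrite mxE. Qed.

Lemma linear_form_homog c : linear_form c \is 1.-homog.
Proof.
by apply: rpred_sum => i _; apply: dhomogZ; rewrite dhomogX; apply/eqP/mdeg1.
Qed.

Lemma dhomog_deriv i k p : p \is k.-homog -> p^`M(i) \is k.-1.-homog.
Proof.
move=> hp; apply/dhomogP => m; rewrite mcoeff_msupp mcoeff_mderiv => pm.
have /(dhomog_mf hp) /= <- : (m + U_(i))%MM \in msupp p.
  by rewrite mcoeff_msupp; apply: contraNneq pm => ->; rewrite mul0rn.
by rewrite mdegD mdeg1 addn1.
Qed.

Lemma dhomog_der_const e k p :
  p \is k.-homog -> der (const_field e) p \is k.-1.-homog.
Proof.
move=> hp; apply: rpred_sum => i _; rewrite mxE mul_mpolyC; apply: dhomogZ.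
exact: dhomog_deriv.
Qed.

(** The residue modulo the ideal of the origin, which detects whether a system
    of homogeneous generators is minimal. *)
Definition eval0 p := p.@[fun=> 0 : K].

Lemma eval0_homog k p : (0 < k)%N -> p \is k.-homog -> eval0 p = 0.
Proof.
case: k => // k _ hp; rewrite /eval0 mevalE big_seq big1 // => m /(dhomog_mf hp) /= mk.
suff /existsP[i mi] : [exists i, m i != 0%N].
  by rewrite (bigD1 i) //= expr0n (negbTE mi) mul0r mulr0.
rewrite -negb_forall; apply: contra_eqN mk => /forallP m0.
by rewrite mdegE big1 // => i _; apply/eqP.
Qed.

Lemma eval0_0 : eval0 0 = 0.
Proof. exact: meval0. Qed.

Lemma eval0_linear_form c : eval0 (linear_form c) = 0.
Proof.
rewrite /eval0 raddf_sum big1 //= => i _.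
by rewrite mevalZ mevalXU mulr0.
Qed.

Section DerProducts.
Variables (I : eqType) (c : I -> 'rV[K]_n).
Implicit Types s : seq I.
Local Notation l i := (linear_form (c i)).

Lemma der_prod_eq0 v s : {in s, forall i, der v (l i) = 0} ->
  der v (\prod_(i <- s) l i) = 0.
Proof.
elim: s => [|a s IH] s0; first by rewrite big_nil -mpolyC1 derC.
rewrite big_cons derM s0 ?mem_head // mul0r add0r IH ?mulr0 // => i si.
by apply: s0; rewrite inE si orbT.
Qed.

Lemma euler_prod s :
  der euler (\prod_(i <- s) l i) = (size s)%:R * \prod_(i <- s) l i.
Proof.
elim: s => [|a s IH]; first by rewrite big_nil -mpolyC1 derC mul0r.
by rewrite !big_cons derM IH der_euler_form /= -(natr1 (size s)); ring.
Qed.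

Lemma prod_homog s : \prod_(i <- s) l i \is (size s).-homog.
Proof.
elim: s => [|a s IH]; first by rewrite big_nil; apply: dhomog1.
by rewrite big_cons /= -add1n; apply: dhomogM => //; apply: linear_form_homog.
Qed.

(** By Leibniz, modulo l_j only the term der v l_j times the product of the
    other forms survives, and l_j divides none of these forms. *)
Lemma der_tangent v s j : {in s, forall i, c i != 0} -> distinct_forms c s ->
  der v (\prod_(i <- s) l i) = 0 -> j \in s -> divides (l j) (der v (l j)).
Proof.
move=> s0 [us ds] + js; rewrite (big_rem j) //= derM => /eqP.
rewrite addr_eq0 => /eqP dE.
have : divides (l j) (der v (l j) * \prod_(i <- rem j s) l i).
  by rewrite dE -mulrN mulrC; apply: divides_mull; apply: divides_refl.
case/(linear_form_prime (s0 j js)) => //.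
case/not_divides_prod; first exact: s0.
move=> i; rewrite (mem_rem_uniq _ us) => /andP[/= ij si].
by apply: ds => //; rewrite eq_sym.
Qed.

End DerProducts.
End Derivations.

(** * Coordinates in a basis of the ambient space *)

Section Frames.
Variables (K : fieldType) (n : nat) (P Q : 'M[K]_n) (PQ1 : P *m Q = 1%:M).
Implicit Types (p : {mpoly K[n]}) (v : 'rV[{mpoly K[n]}]_n).

(** The rows of P are the basis vectors, and the columns of Q the coefficients of
    the dual coordinates. *)
Definition coord k : {mpoly K[n]} := linear_form (\row_i Q i k).
Definition partial k p := der (const_field (row k P)) p.

Lemma frame_dot j k : dot (\row_i Q i k) (row j P) = (j == k)%:R.
Proof.
have := congr1 (fun M : 'M_n => M j k) PQ1; rewrite !mxE => <-.
by apply: eq_bigr => i _; rewrite !mxE mulrC.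
Qed.

Lemma partial_coord j k : partial j (coord k) = (j == k)%:R.
Proof. by rewrite /partial /coord der_const_form frame_dot mpolyC_nat. Qed.

(** The identity Q P = 1, read on vector fields. *)
Lemma frame_decomp v :
  v = \sum_k der v (coord k) *: const_field (row k P).
Proof.
apply/rowP => j; rewrite summxE.
transitivity (\sum_i (1%:M : 'M[K]_n) i j *: v 0 i).
  rewrite (bigD1 j) //= mxE eqxx scale1r big1 ?addr0 // => i /negbTE ij.
  by rewrite mxE ij scale0r.
rewrite -(mulmx1C PQ1).
under eq_bigr do rewrite mxE scaler_suml.
rewrite exchange_big; apply: eq_bigr => k _; rewrite !mxE der_form mulr_suml.
by apply: eq_bigr => i _; rewrite !mxE [RHS]mulrC mul_mpolyC scalerA mulrC.
Qed.

(** The chain rule for the linear change of coordinates. *)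
Lemma der_frame v p : der v p = \sum_k der v (coord k) * partial k p.
Proof.
rewrite {1}(frame_decomp v) /der.
under eq_bigr do rewrite summxE mulr_suml.
rewrite exchange_big; apply: eq_bigr => k _; rewrite /partial /der mulr_sumr.
by apply: eq_bigr => i _; rewrite !mxE mulrA.
Qed.

Lemma linear_form_frame c :
  linear_form c = \sum_k dot c (row k P) *: coord k.
Proof.
rewrite -[LHS]der_euler_form der_frame; apply: eq_bigr => k _.
by rewrite [der _ (coord k)]der_euler_form /partial der_const_form mulrC mul_mpolyC.
Qed.

Lemma eval_coord j k : (coord k).@[fun i => row j P 0 i] = (j == k)%:R.
Proof. by rewrite linear_form_eval frame_dot. Qed.

Lemma coord_vector_neq0 k : \row_i Q i k != 0.
Proof.
apply/eqP => q0; have := frame_dot k k; rewrite q0 eqxx /dot big1.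
  by move/esym/eqP; rewrite oner_eq0.
by move=> i _; rewrite mxE mul0r.
Qed.

Lemma not_divides_coord j k : j != k -> ~ divides (coord j) (coord k).
Proof.
move=> jk [r rE].
have := congr1 (meval (fun i => row k P 0 i)) rE.
rewrite mevalM !eval_coord eqxx eq_sym (negbTE jk) mulr0.
by move/eqP; rewrite oner_eq0.
Qed.

End Frames.

(** * Forms in two linear variables *)

Section Pencils.
Variables (K : fieldType) (n : nat) (I : eqType) (c : I -> 'rV[K]_n).
Implicit Types (u w p : {mpoly K[n]}) (s : seq I) (v : 'rV[{mpoly K[n]}]_n).
Local Notation l i := (linear_form (c i)).

Lemma prod_forms_neq0 s : {in s, forall i, c i != 0} ->
  \prod_(i <- s) l i != 0.
Proof.
by move=> s0; rewrite prodf_seq_neq0; apply/allP => i /s0; rewrite linear_form_eq0.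
Qed.

(** For l = a u + b w, the determinant of the two vectors (u, w) and
    (der v u, der v w) is zero modulo l, since (a, b) is orthogonal to both
    of them modulo l. This holds for each form of the pencil, hence for their
    product. *)
Lemma pencil_wedge u w v s : {in s, forall i, c i != 0} -> distinct_forms c s ->
  {in s, forall i, exists a b, l i = a *: u + b *: w} ->
  {in s, forall i, divides (l i) (der v (l i))} ->
  divides (\prod_(i <- s) l i) (w * der v u - u * der v w).
Proof.
move=> s0 ds su sv; apply: prod_linear_forms_divides => // i si.
have [a [b lE]] := su i si; have [r dE] := sv i si.
have {}dE : a *: der v u + b *: der v w = r * l i by rewrite -dE lE derD !derZ.
have [a0|an0] := eqVneq a 0; last first.
  exists (a^-1 *: (w * r - der v w)).
  rewrite -scalerAl mulrBl -mulrA -dE lE; apply/(scalerI an0).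
  by rewrite scalerA divff // scale1r -!mul_mpolyC; ring.
have bn0 : b != 0.
  apply: contraTneq (s0 i si) => b0; rewrite negbK -linear_form_eq0 lE a0 b0.
  by rewrite !scale0r addr0.
exists (b^-1 *: (der v u - u * r)).
rewrite -scalerAl mulrBl -mulrA -dE lE; apply/(scalerI bn0).
by rewrite scalerA divff // scale1r a0 -!mul_mpolyC mpolyC0; ring.
Qed.

Lemma pencil_mod u w s :
  {in s, forall i, exists a b, a != 0 /\ l i = a *: u + b *: w} ->
  exists a r, a != 0 /\ \prod_(i <- s) l i = a *: u ^+ size s + w * r.
Proof.
elim: s => [|j s IH] su.
  by exists 1, 0; rewrite oner_eq0 big_nil mulr0 addr0 scale1r.
case: IH => [i si|a [r [a0 pE]]]; first by apply: su; rewrite inE si orbT.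
have [a' [b' [a'0 lE]]] := su j (mem_head _ _).
exists (a' * a), (b' *: (a *: u ^+ size s + w * r) + a' *: u * r).
rewrite mulf_neq0 // big_cons pE lE /=; split=> //.
by rewrite exprS -!mul_mpolyC mpolyCM; ring.
Qed.

Lemma linear_form_exp_divides (e : 'rV[K]_n) k p q : e != 0 ->
  ~ divides (linear_form e) q ->
  divides (linear_form e ^+ k) (p * q) -> divides (linear_form e ^+ k) p.
Proof.
move=> e0 lq; elim: k p => [|k IH] p.
  by move=> _; exists p; rewrite expr0 mulr1.
move=> [r pqE].
have : divides (linear_form e) (p * q).
  by exists (r * linear_form e ^+ k); rewrite pqE exprS; ring.
case/(linear_form_prime e0) => // -[t pE].
have [|s tE] := IH t; last by exists s; rewrite pE tE exprS; ring.
exists r; apply: (@mulIf _ (linear_form e)); first by rewrite linear_form_eq0.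
by rewrite -[RHS]mulrA -exprSr -pqE pE; ring.
Qed.

End Pencils.

Lemma big3 (V : nmodType) (F : 'I_3 -> V) :
  \sum_k F k = F ord0 + F (lift ord0 ord0) + F (lift ord0 (lift ord0 ord0)).
Proof. by rewrite !big_ord_recl big_ord0 addr0 addrA. Qed.

(** A generator that is a combination of the others gives a relation with a
    coefficient -1, which does not vanish at the origin. *)
Lemma minimal_of_relations (K : fieldType) m (gens : 'I_m -> 'rV[{mpoly K[3]}]_3) :
  (forall a, \sum_j a j *: gens j = 0 -> forall j, eval0 (a j) = 0) ->
  forall j, ~ exists a : 'I_m -> {mpoly K[3]},
    gens j = \sum_(k | k != j) a k *: gens k.
Proof.
move=> rel j [a gE].
suff /rel/(_ j)/eqP : \sum_k (if k == j then -1 else a k) *: gens k = 0.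
  by rewrite eqxx /eval0 mevalN meval1 oppr_eq0 oner_eq0.
rewrite (bigD1 j) //= eqxx {1}gE scaleN1r addrC.
rewrite [X in X - _](_ : _ = \sum_(k | k != j) a k *: gens k) ?subrr //.
by apply: eq_bigr => k /negbTE ->.
Qed.

(** * Syzygies of a union of two pencils *)

Section TwoPencils.
Variables (K : numFieldType) (P Q : 'M[K]_3) (PQ1 : P *m Q = 1%:M).
Variables (I : eqType) (c : I -> 'rV[K]_3) (s1 s2 : seq I).
Local Notation l i := (linear_form (c i)).
Local Notation S := {mpoly K[3]}.
Local Notation k0 := (ord0 : 'I_3).
Local Notation k1 := (lift ord0 ord0 : 'I_3).
Local Notation k2 := (lift ord0 (lift ord0 ord0) : 'I_3).

Let value i k := dot (c i) (row k P).
Let x := coord Q k0.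
Let y := coord Q k1.
Let z := coord Q k2.
Let g : S := \prod_(i <- s1) l i.
Let h : S := \prod_(i <- s2) l i.
Let gy := partial P k1 g.
Let gz := partial P k2 g.
Let hx := partial P k0 h.
Let hz := partial P k2 h.
Let n1 : S := (size s1)%:R.
Let n2 : S := (size s2)%:R.
Let basis k : 'rV[S]_3 := const_field (row k P).
Let euler3 := euler K 3.

(** The products below are g = 0 and h = 0 for the two pencils; the base point of
    the first is the basis vector of index 0, that of the second the basis
    vector of index 1. Clearing the denominator n1 + n2 keeps the coefficients
    of the first two syzygies free of inverses. *)
Definition syzygy1 : 'rV[S]_3 := ((n1 + n2) * g) *: basis k1 - gy *: euler3.
Definition syzygy2 : 'rV[S]_3 := ((n1 + n2) * h) *: basis k0 - hx *: euler3.
Definition syzygy3 : 'rV[S]_3 :=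
  (gy * hz) *: basis k0 + (gz * hx) *: basis k1 - (gy * hx) *: basis k2.

Hypothesis c_neq0 : {in s1 ++ s2, forall i, c i != 0}.
Hypothesis distinct12 : distinct_forms c (s1 ++ s2).
Hypothesis pencil1 : {in s1, forall i, value i k0 = 0}.
Hypothesis pencil2 : {in s2, forall i, value i k1 = 0}.
Hypothesis off_k1 : {in s1, forall i, value i k1 != 0}.
Hypothesis s1_gt0 : (0 < size s1)%N.
Hypothesis s2_gt1 : (1 < size s2)%N.

Lemma c1_neq0 : {in s1, forall i, c i != 0}.
Proof. by move=> i si; apply: c_neq0; rewrite mem_cat si. Qed.

Lemma c2_neq0 : {in s2, forall i, c i != 0}.
Proof. by move=> i si; apply: c_neq0; rewrite mem_cat si orbT. Qed.

Lemma distinct1 : distinct_forms c s1.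
Proof.
case: distinct12 => + d12; rewrite cat_uniq => /andP[u1 _]; split=> // i j si sj.
by apply: d12; rewrite mem_cat ?si ?sj.
Qed.

Lemma distinct2 : distinct_forms c s2.
Proof.
case: distinct12 => + d12; rewrite cat_uniq => /and3P[_ _ u2]; split=> // i j si sj.
by apply: d12; rewrite mem_cat ?si ?sj orbT.
Qed.

Lemma form_xyz i : l i = value i k0 *: x + value i k1 *: y + value i k2 *: z.
Proof. by rewrite [LHS](linear_form_frame PQ1) big3. Qed.

Lemma der_xyz v p : der v p =
  der v x * partial P k0 p + der v y * partial P k1 p + der v z * partial P k2 p.
Proof. by rewrite [LHS](der_frame PQ1) big3. Qed.

Lemma partial0_g : partial P k0 g = 0.
Proof.
apply: der_prod_eq0 => i /pencil1 i0.
by rewrite der_const_form -/(value _ _) i0 mpolyC0.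
Qed.

Lemma partial1_h : partial P k1 h = 0.
Proof.
apply: der_prod_eq0 => i /pencil2 i0.
by rewrite der_const_form -/(value _ _) i0 mpolyC0.
Qed.

Lemma euler_g : y * gy + z * gz = n1 * g.
Proof.
rewrite -euler_prod der_xyz partial0_g mulr0 add0r.
by rewrite !der_euler_form.
Qed.

Lemma euler_h : x * hx + z * hz = n2 * h.
Proof.
rewrite -euler_prod der_xyz partial1_h mulr0 addr0.
by rewrite !der_euler_form.
Qed.

Lemma der_gh v : der v (g * h) =
  der v x * (g * hx) + der v y * (gy * h) + der v z * (gz * h + g * hz).
Proof.
rewrite derM (der_xyz v g) (der_xyz v h) partial0_g partial1_h.
by rewrite -/gy -/gz -/hx -/hz; ring.
Qed.

Lemma g_neq0 : g != 0. Proof. exact: prod_forms_neq0 c1_neq0. Qed.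
Lemma h_neq0 : h != 0. Proof. exact: prod_forms_neq0 c2_neq0. Qed.

Lemma nat_mpoly_neq0 k : (0 < k)%N -> (k%:R : S) != 0.
Proof. by move=> k_gt0; rewrite -mpolyC_nat mpolyC_eq0 pnatr_eq0 -lt0n. Qed.

Lemma nat_mpoly_unit k : (0 < k)%N -> exists u : S, u * k%:R = 1.
Proof.
move=> k_gt0; exists (k%:R^-1)%:MP; rewrite -mpolyC_nat -mpolyCM mulVf ?mpolyC1 //.
by rewrite pnatr_eq0 -lt0n.
Qed.

Lemma z_neq0 : z != 0.
Proof.
apply/eqP => z0; have := partial_coord PQ1 k2 k2.
rewrite -/z z0 /partial -mpolyC0 derC eqxx => /esym/eqP.
by rewrite oner_eq0.
Qed.

(** Two components of the exterior product of v with the Euler field; they vanish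
    together exactly when v is proportional to it. *)
Definition wedge0 v := z * der v x - x * der v z.
Definition wedge1 v := z * der v y - y * der v z.

Lemma der_lincomb a1 a2 a3 (v u1 u2 u3 : 'rV[S]_3) p :
  der (v - (a1 *: u1 + a2 *: u2 + a3 *: u3)) p =
  der v p - (a1 * der u1 p + a2 * der u2 p + a3 * der u3 p).
Proof. by rewrite der_addl der_oppl !der_addl !der_scalel. Qed.

Lemma der_lincomb_eq0 a1 a2 a3 (v u1 u2 u3 : 'rV[S]_3) p :
  der v p = 0 -> der u1 p = 0 -> der u2 p = 0 -> der u3 p = 0 ->
  der (v - (a1 *: u1 + a2 *: u2 + a3 *: u3)) p = 0.
Proof.
by move=> dv d1 d2 d3; rewrite der_lincomb dv d1 d2 d3 !mulr0 !addr0 subr0.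
Qed.

Lemma wedge0_lincomb a1 a2 a3 v u1 u2 u3 w w1 w2 w3 :
  wedge0 v = w -> wedge0 u1 = w1 -> wedge0 u2 = w2 -> wedge0 u3 = w3 ->
  wedge0 (v - (a1 *: u1 + a2 *: u2 + a3 *: u3)) =
  w - (a1 * w1 + a2 * w2 + a3 * w3).
Proof. by move=> <- <- <- <-; rewrite /wedge0 !der_lincomb; ring. Qed.

Lemma wedge1_lincomb a1 a2 a3 v u1 u2 u3 w w1 w2 w3 :
  wedge1 v = w -> wedge1 u1 = w1 -> wedge1 u2 = w2 -> wedge1 u3 = w3 ->
  wedge1 (v - (a1 *: u1 + a2 *: u2 + a3 *: u3)) =
  w - (a1 * w1 + a2 * w2 + a3 * w3).
Proof. by move=> <- <- <- <-; rewrite /wedge1 !der_lincomb; ring. Qed.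

Lemma der_basis j k : der (basis j) (coord Q k) = (j == k)%:R.
Proof. exact: partial_coord. Qed.

Lemma der_syzygy1 k : der syzygy1 (coord Q k) =
  (n1 + n2) * g * (k1 == k)%:R - gy * coord Q k.
Proof.
by rewrite /syzygy1 der_addl der_oppl !der_scalel der_basis der_euler_form.
Qed.

Lemma der_syzygy2 k : der syzygy2 (coord Q k) =
  (n1 + n2) * h * (k0 == k)%:R - hx * coord Q k.
Proof.
by rewrite /syzygy2 der_addl der_oppl !der_scalel der_basis der_euler_form.
Qed.

Lemma der_syzygy3 k : der syzygy3 (coord Q k) =
  gy * hz * (k0 == k)%:R + gz * hx * (k1 == k)%:R - gy * hx * (k2 == k)%:R.
Proof.
by rewrite /syzygy3 !der_addl der_oppl !der_scalel !der_basis.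
Qed.

Lemma hx_homog : hx \is (size s2).-1.-homog.
Proof. by apply: dhomog_der_const; apply: prod_homog. Qed.
Lemma hz_homog : hz \is (size s2).-1.-homog.
Proof. by apply: dhomog_der_const; apply: prod_homog. Qed.
Lemma gy_homog : gy \is (size s1).-1.-homog.
Proof. by apply: dhomog_der_const; apply: prod_homog. Qed.
Lemma gz_homog : gz \is (size s1).-1.-homog.
Proof. by apply: dhomog_der_const; apply: prod_homog. Qed.

Lemma homogeneousD k (u v : 'rV[S]_3) :
  homogeneous k u -> homogeneous k v -> homogeneous k (u + v).
Proof. by move=> hu hv i; rewrite mxE; apply: rpredD. Qed.

Lemma homogeneousN k (u : 'rV[S]_3) : homogeneous k u -> homogeneous k (- u).
Proof. by move=> hu i; rewrite mxE rpredN. Qed.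

Lemma homogeneousZ k m p (u : 'rV[S]_3) :
  p \is k.-homog -> homogeneous m u -> homogeneous (k + m) (p *: u).
Proof. by move=> hp hu i; rewrite mxE; apply: dhomogM. Qed.

Lemma homogeneous_basis k : homogeneous 0 (basis k).
Proof. by move=> i; rewrite mxE -[_%:MP]mulr1 mul_mpolyC; apply/dhomogZ/dhomog1. Qed.

Lemma homogeneous_euler : homogeneous 1 euler3.
Proof. by move=> i; rewrite mxE dhomogX; apply/eqP/mdeg1. Qed.

Lemma n12M_homog k (p : S) : p \is k.-homog -> (n1 + n2) * p \is k.-homog.
Proof. by move=> hp; rewrite -natrD -mpolyC_nat mul_mpolyC; apply: dhomogZ. Qed.

Lemma syzygy1_homog : homogeneous (size s1) syzygy1.
Proof.
apply: homogeneousD.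
  rewrite -[size s1]addn0; apply: homogeneousZ (homogeneous_basis _).
  by apply: n12M_homog; apply: prod_homog.
apply: homogeneousN; rewrite -(prednK s1_gt0) -addn1.
by apply: homogeneousZ homogeneous_euler; apply: gy_homog.
Qed.

Lemma syzygy2_homog : homogeneous (size s2) syzygy2.
Proof.
apply: homogeneousD.
  rewrite -[size s2]addn0; apply: homogeneousZ (homogeneous_basis _).
  by apply: n12M_homog; apply: prod_homog.
apply: homogeneousN; rewrite -(prednK (ltnW s2_gt1)) -addn1.
by apply: homogeneousZ homogeneous_euler; apply: hx_homog.
Qed.

Lemma syzygy3_homog : homogeneous (size s1 + size s2 - 2)%N syzygy3.
Proof.
have -> : (size s1 + size s2 - 2 = (size s1).-1 + (size s2).-1 + 0)%N.
  by rewrite -(prednK s1_gt0) -(prednK (ltnW s2_gt1)) addSn addnS subn2 addn0.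
have M := @dhomogM _ _ _ (size s1).-1 _ (size s2).-1.
apply: homogeneousD; last apply: homogeneousN; last first.
  by apply: homogeneousZ (homogeneous_basis _); apply: M gy_homog hx_homog.
apply: homogeneousD; apply: homogeneousZ (homogeneous_basis _); apply: M.
- exact: gy_homog.
- exact: hz_homog.
- exact: gz_homog.
- exact: hx_homog.
Qed.

Lemma wedge0_syzygy1 : wedge0 syzygy1 = 0.
Proof. by rewrite /wedge0 !der_syzygy1 /= -/x -/y -/z; ring. Qed.
Lemma wedge1_syzygy1 : wedge1 syzygy1 = (n1 + n2) * z * g.
Proof. by rewrite /wedge1 !der_syzygy1 /= -/x -/y -/z; ring. Qed.
Lemma wedge0_syzygy2 : wedge0 syzygy2 = (n1 + n2) * z * h.
Proof. by rewrite /wedge0 !der_syzygy2 /= -/x -/y -/z; ring. Qed.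
Lemma wedge1_syzygy2 : wedge1 syzygy2 = 0.
Proof. by rewrite /wedge1 !der_syzygy2 /= -/x -/y -/z; ring. Qed.
Lemma wedge0_syzygy3 : wedge0 syzygy3 = n2 * gy * h.
Proof.
rewrite /wedge0 !der_syzygy3 /=; transitivity (gy * (n2 * h)); last by ring.
by rewrite -euler_h; ring.
Qed.
Lemma wedge1_syzygy3 : wedge1 syzygy3 = n1 * hx * g.
Proof.
rewrite /wedge1 !der_syzygy3 /=; transitivity (hx * (n1 * g)); last by ring.
by rewrite -euler_g; ring.
Qed.

Lemma syzygy1P : der syzygy1 (g * h) = 0.
Proof.
rewrite der_gh !der_syzygy1 /= -/x -/y -/z.
transitivity (gy * h * (n1 * g - (y * gy + z * gz))
  + gy * g * (n2 * h - (x * hx + z * hz))); first by ring.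
by rewrite euler_g euler_h !subrr !mulr0 addr0.
Qed.

Lemma syzygy2P : der syzygy2 (g * h) = 0.
Proof.
rewrite der_gh !der_syzygy2 /= -/x -/y -/z.
transitivity (hx * h * (n1 * g - (y * gy + z * gz))
  + hx * g * (n2 * h - (x * hx + z * hz))); first by ring.
by rewrite euler_g euler_h !subrr !mulr0 addr0.
Qed.

Lemma syzygy3P : der syzygy3 (g * h) = 0.
Proof. by rewrite der_gh !der_syzygy3 /=; ring. Qed.

Lemma wedge0_divides v : der v (g * h) = 0 -> exists q, wedge0 v = q * h.
Proof.
move=> vgh; apply: pencil_wedge c2_neq0 distinct2 _ _ => i si.
  exists (value i k0), (value i k2).
  by rewrite form_xyz pencil2 // scale0r addr0.
apply: der_tangent c_neq0 distinct12 _ _; last by rewrite mem_cat si orbT.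
by rewrite big_cat.
Qed.

Lemma wedge1_divides v : der v (g * h) = 0 -> exists q, wedge1 v = q * g.
Proof.
move=> vgh; apply: pencil_wedge c1_neq0 distinct1 _ _ => i si.
  exists (value i k1), (value i k2).
  by rewrite form_xyz pencil1 // scale0r add0r.
apply: der_tangent c_neq0 distinct12 _ _; last by rewrite mem_cat si.
by rewrite big_cat.
Qed.

(** Multiply der v (g h) = 0 by z, eliminate z (der v x) and z (der v y), and use
    Euler's formula for g and h: the result is g h times this relation. *)
Lemma der_z_wedge v q1 q2 : der v (g * h) = 0 ->
  wedge1 v = q1 * g -> wedge0 v = q2 * h ->
  (n1 + n2) * der v z = - (hx * q2 + gy * q1).
Proof.
move=> vgh w1 w0; apply/eqP; rewrite -subr_eq0 opprK.
have : z * der v (g * h) = 0 by rewrite vgh mulr0.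
have -> : z * der v (g * h) = (wedge0 v * (g * hx) + wedge1 v * (gy * h)
    + der v z * (h * (y * gy + z * gz) + g * (x * hx + z * hz))).
  by rewrite der_gh /wedge0 /wedge1; ring.
rewrite w0 w1 euler_g euler_h => /eqP eq0.
have /eqP : g * h * ((n1 + n2) * der v z + (hx * q2 + gy * q1)) = 0.
  by rewrite -(eqP eq0); ring.
by rewrite mulf_eq0 mulf_eq0 (negbTE g_neq0) (negbTE h_neq0).
Qed.

Lemma n12_neq0 : n1 + n2 != 0.
Proof. by rewrite -natrD nat_mpoly_neq0 // addn_gt0 s1_gt0. Qed.

Lemma wedge_inj v : der v (g * h) = 0 -> wedge1 v = 0 -> wedge0 v = 0 -> v = 0.
Proof.
move=> vgh w1 w0.
have /eqP : (n1 + n2) * der v z = 0.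
  by rewrite (der_z_wedge (q1 := 0) (q2 := 0)) ?mul0r //; ring.
rewrite mulf_eq0 (negbTE n12_neq0) => /eqP vz.
move: w0 w1; rewrite /wedge0 /wedge1 vz !mulr0 !subr0 => /eqP + /eqP.
rewrite !mulf_eq0 (negbTE z_neq0) => /eqP vx /eqP vy.
by rewrite (frame_decomp PQ1 v) big3 vx vy vz !scale0r !addr0.
Qed.

(** By injectivity, a decomposition only has to be checked on the two wedges. *)
Lemma wedge_generates v a1 a2 a3 : der v (g * h) = 0 ->
  wedge1 v = (a1 * ((n1 + n2) * z) + a3 * (n1 * hx)) * g ->
  wedge0 v = (a2 * ((n1 + n2) * z) + a3 * (n2 * gy)) * h ->
  v = a1 *: syzygy1 + a2 *: syzygy2 + a3 *: syzygy3.
Proof.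
move=> vgh w1 w0; apply/eqP; rewrite -subr_eq0; apply/eqP.
apply: wedge_inj.
- exact: der_lincomb_eq0 vgh syzygy1P syzygy2P syzygy3P.
- rewrite (wedge1_lincomb _ _ _ w1 wedge1_syzygy1 wedge1_syzygy2 wedge1_syzygy3).
  ring.
- rewrite (wedge0_lincomb _ _ _ w0 wedge0_syzygy1 wedge0_syzygy2 wedge0_syzygy3).
  ring.
Qed.

Lemma eval_prod_neq0 s k : {in s, forall i, value i k != 0} ->
  (\prod_(i <- s) l i).@[fun i => row k P 0 i] != 0.
Proof.
move=> sk; rewrite rmorph_prod prodf_seq_neq0; apply/allP => i /sk.
by rewrite /= linear_form_eval.
Qed.

(** Euler's formula at the basis vector of index k, where z vanishes and the
    product of the forms does not. *)
Lemma not_divides_z k s p q : (0 < size s)%N ->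
  {in s, forall i, value i k != 0} -> k2 != k ->
  coord Q k * p + z * q = (size s)%:R * \prod_(i <- s) l i -> ~ divides z p.
Proof.
move=> s_gt0 sk kn2 E [r rE].
have := eval_prod_neq0 sk; apply/negP; rewrite negbK.
have := congr1 (meval (fun i => row k P 0 i)) E.
rewrite rE -mpolyC_nat mevalD !mevalM mevalC !(eval_coord PQ1).
rewrite eq_sym (negbTE kn2) mulr0 mul0r mulr0 addr0 => /esym/eqP.
by rewrite mulf_eq0 pnatr_eq0 eqn0Ngt s_gt0.
Qed.

Lemma wedge_relation a1 a2 a3 :
  a1 *: syzygy1 + a2 *: syzygy2 + a3 *: syzygy3 = 0 ->
  a1 * ((n1 + n2) * z) + a3 * (n1 * hx) = 0 /\
  a2 * ((n1 + n2) * z) + a3 * (n2 * gy) = 0.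
Proof.
move=> E.
have w0 : wedge0 0 = 0 by rewrite /wedge0 !der0l !mulr0 subr0.
have w1 : wedge1 0 = 0 by rewrite /wedge1 !der0l !mulr0 subr0.
split; [apply: (mulIf g_neq0)|apply: (mulIf h_neq0)].
  have := wedge1_lincomb a1 a2 a3 w1 wedge1_syzygy1 wedge1_syzygy2 wedge1_syzygy3.
  by rewrite E subr0 w1 => /esym/eqP; rewrite sub0r oppr_eq0 mul0r => /eqP <-; ring.
have := wedge0_lincomb a1 a2 a3 w0 wedge0_syzygy1 wedge0_syzygy2 wedge0_syzygy3.
by rewrite E subr0 w0 => /esym/eqP; rewrite sub0r oppr_eq0 mul0r => /eqP <-; ring.
Qed.

(** ** Two pencils with at least two lines each *)

Section LargePencils.
Hypothesis off_k0 : {in s2, forall i, value i k0 != 0}.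
Hypothesis s1_gt1 : (1 < size s1)%N.

Lemma g_mod_z : exists b r, b != 0 /\ g = b *: y ^+ size s1 + z * r.
Proof.
apply: pencil_mod => i si; exists (value i k1), (value i k2).
by rewrite off_k1 // form_xyz pencil1 // scale0r add0r.
Qed.

Lemma h_mod_z : exists a r, a != 0 /\ h = a *: x ^+ size s2 + z * r.
Proof.
apply: pencil_mod => i si; exists (value i k0), (value i k2).
by rewrite off_k0 // form_xyz pencil2 // scale0r addr0.
Qed.

(** Multiplying wedge0 v = q2 h by n1 + n2 and replacing (n1 + n2) der v z by its
    value in q1 and q2 leaves (n1 + n2) z (der v x) on one side. *)
Lemma wedge_congruence v q1 q2 : der v (g * h) = 0 ->
  wedge1 v = q1 * g -> wedge0 v = q2 * h ->
  divides z (n1 * h * q2 - x * gy * q1).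
Proof.
move=> vgh w1 w0; exists ((n1 + n2) * der v x - hz * q2).
have dz := der_z_wedge vgh w1 w0.
have -> : n1 * h * q2 - x * gy * q1 =
    (n1 + n2) * (q2 * h) - (n2 * h) * q2 - x * gy * q1 by ring.
rewrite -w0 -euler_h /wedge0.
transitivity ((n1 + n2) * der v x * z - z * hz * q2
  - x * ((n1 + n2) * der v z + (hx * q2 + gy * q1))); first by ring.
by rewrite dz; ring.
Qed.

(** Modulo z one has h = a x^n2 and g = b y^n1, so the congruence becomes
    a x^(n2-1) q2 = b y^(n1-1) q1 after division by n1 x. As x and y are
    distinct primes, q2 = w y^(n1-1) there, and q1 follows. *)
Lemma congruence_solution q1 q2 : divides z (n1 * h * q2 - x * gy * q1) ->
  exists w r1 r2, q1 = w * (n1 * hx) + z * r1 /\ q2 = w * (n2 * gy) + z * r2.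
Proof.
have [b [t [b0 gE]]] := g_mod_z; have [a [r [a0 hE]]] := h_mod_z.
have [m1 s1E] : exists m1, size s1 = m1.+1 by exists (size s1).-1; rewrite prednK.
have [m2 s2E] : exists m2, size s2 = m2.+1.
  by exists (size s2).-1; rewrite prednK // ltnW.
have gyE : gy = n1 * (b *: y ^+ m1) + z * partial P k1 t.
  rewrite /gy gE s1E /partial derD derZ derM der_exp.
  rewrite !(der_basis k1) /= /n1 s1E -!mul_mpolyC; ring.
have hxE : hx = n2 * (a *: x ^+ m2) + z * partial P k0 r.
  rewrite /hx hE s2E /partial derD derZ derM der_exp.
  rewrite !(der_basis k0) /= /n2 s2E -!mul_mpolyC; ring.
rewrite gyE hE s2E => zq.
have z2 := coord_vector_neq0 PQ1 k2.
(* Keep only the terms of the congruence outside (z), then cancel n1 and x. *)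
have {}zq : divides z (a *: x ^+ m2 * q2 - b *: y ^+ m1 * q1).
  have : divides z (n1 * x * (a *: x ^+ m2 * q2 - b *: y ^+ m1 * q1)).
    case: zq => s sE; exists (s - n1 * r * q2 + x * partial P k1 t * q1).
    rewrite mulrDl mulrBl -sE -!mul_mpolyC exprS; ring.
  case/(linear_form_prime z2) => // /(linear_form_prime z2)[].
    case=> s n1E; have [u uE] := nat_mpoly_unit s1_gt0.
    by case: (not_divides1 z2); exists (u * s); rewrite -mulrA -n1E.
  by move/(not_divides_coord PQ1) => /(_ isT).
have dz := frame_dot PQ1 k2 k2; rewrite eqxx in dz.
(* The projection pi along ez fixes x and y and kills z: it turns the congruence
   into an equality of polynomials. *)
set pi := proj_along (\row_i Q i k2) (row k2 P).
have piM p q : pi (p * q) = pi p * pi q by exact: proj_alongM.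
have piZ e p : pi (e *: p) = e *: pi p by exact: comp_mpolyZ.
have piX p k : pi (p ^+ k) = pi p ^+ k by exact: rmorphXn.
have piB p q : pi (p - q) = pi p - pi q by exact: raddfB.
have pix : pi x = x by rewrite /pi proj_along_form (frame_dot PQ1) scale0r subr0.
have piy : pi y = y by rewrite /pi proj_along_form (frame_dot PQ1) scale0r subr0.
have piE : a *: x ^+ m2 * pi q2 = b *: y ^+ m1 * pi q1.
  move/(proj_along_eq0 _ dz)/eqP: zq; rewrite -/pi piB subr_eq0.
  by rewrite !piM !piZ !piX pix piy => /eqP.
have bb : b^-1%:MP * b%:MP = 1 :> S by rewrite -mpolyCM mulVf.
have aa : a^-1%:MP * a%:MP = 1 :> S by rewrite -mpolyCM mulVf.
have y2 := coord_vector_neq0 PQ1 k1.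
have [w wE] : divides (y ^+ m1) (pi q2).
  apply: (linear_form_exp_divides (q := x ^+ m2) y2).
    elim: m2 {s2E hE hxE zq piE} => [|m IH]; first exact: not_divides1.
    rewrite exprS => /(linear_form_prime y2)[] //.
    by move/(not_divides_coord PQ1) => /(_ isT).
  exists (a^-1%:MP * b%:MP * pi q1).
  transitivity (a^-1%:MP * (b *: y ^+ m1 * pi q1)); last by rewrite -mul_mpolyC; ring.
  rewrite -piE -mul_mpolyC.
  transitivity (a^-1%:MP * a%:MP * (x ^+ m2 * pi q2)); last by ring.
  by rewrite aa mul1r mulrC.
have y0 : y ^+ m1 != 0 by rewrite expf_neq0 // linear_form_eq0.
have q1E : pi q1 = b^-1%:MP * a%:MP * w * x ^+ m2.
  apply: (mulfI y0).
  transitivity (b^-1%:MP * (a *: x ^+ m2 * pi q2)); last first.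
    by rewrite wE -mul_mpolyC; ring.
  rewrite piE -mul_mpolyC.
  transitivity (b^-1%:MP * b%:MP * (y ^+ m1 * pi q1)); last by ring.
  by rewrite bb mul1r.
have [u1 u1E] := nat_mpoly_unit s1_gt0.
have [u2 u2E] := nat_mpoly_unit (ltnW s2_gt1).
have [t1 t1E] : divides z (q1 - pi q1) by apply: proj_along_mod.
have [t2 t2E] : divides z (q2 - pi q2) by apply: proj_along_mod.
(* n2 g_y is congruent to n1 n2 b y^(n1-1); this constant is divided out of w. *)
pose w' := u1 * u2 * b^-1%:MP * w.
exists w', (t1 - w' * n1 * partial P k0 r), (t2 - w' * n2 * partial P k1 t).
split.
  rewrite -[q1 in LHS](subrK (pi q1)) t1E q1E hxE -mul_mpolyC.
  transitivity (t1 * z + (u1 * n1) * (u2 * n2) * (b^-1%:MP * a%:MP * w * x ^+ m2)).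
    by rewrite u1E u2E !mul1r.
  by rewrite /w'; ring.
rewrite -[q2 in LHS](subrK (pi q2)) t2E wE -mul_mpolyC.
transitivity (t2 * z + (u1 * n1) * (u2 * n2) * (b^-1%:MP * b%:MP) * (w * y ^+ m1)).
  by rewrite u1E u2E bb !mul1r.
by rewrite /w'; ring.
Qed.

Lemma syzygies_generate v : der v (g * h) = 0 ->
  exists a1 a2 a3, v = a1 *: syzygy1 + a2 *: syzygy2 + a3 *: syzygy3.
Proof.
move=> vgh; have [q1 w1] := wedge1_divides vgh.
have [q2 w0] := wedge0_divides vgh.
have [w [r1 [r2 [q1E q2E]]]] :=
  congruence_solution (wedge_congruence vgh w1 w0).
have [|u uE] := @nat_mpoly_unit (size s1 + size s2); first by rewrite addn_gt0 s1_gt0.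
rewrite natrD -/n1 -/n2 in uE.
exists (u * r1), (u * r2), w; apply: wedge_generates => //.
  rewrite w1 q1E -[z * r1]mul1r -uE; ring.
rewrite w0 q2E -[z * r2]mul1r -uE; ring.
Qed.

(** As z is prime and does not divide g_y, the second relation between the wedges
    shows that z divides a3. Dividing both relations by z, the coefficients a1
    and a2 are multiples of h_x and g_y, which are homogeneous of positive
    degree. *)
Lemma relation_eval0 a1 a2 a3 :
  a1 *: syzygy1 + a2 *: syzygy2 + a3 *: syzygy3 = 0 ->
  [/\ eval0 a1 = 0, eval0 a2 = 0 & eval0 a3 = 0].
Proof.
case/wedge_relation => E1 E2.
have zgy : ~ divides z gy by apply: not_divides_z euler_g.
have [u2 u2E] := nat_mpoly_unit (ltnW s2_gt1).
have [t tE] : divides z a3.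
  have : divides z (a3 * gy).
    exists (- u2 * a2 * (n1 + n2)).
    transitivity (u2 * n2 * (a3 * gy)); first by rewrite u2E mul1r.
    transitivity (u2 * (a2 * ((n1 + n2) * z) + a3 * (n2 * gy))
      - u2 * a2 * (n1 + n2) * z); first by ring.
    by rewrite E2; ring.
  by case/(linear_form_prime (coord_vector_neq0 PQ1 k2)).
have n12_eval0 p : eval0 ((n1 + n2) * p) = 0 -> eval0 p = 0.
  rewrite /eval0 -natrD -mpolyC_nat mevalM mevalC => /eqP.
  by rewrite mulf_eq0 pnatr_eq0 eqn0Ngt addn_gt0 s1_gt0 => /eqP.
have eval0M0 p q : eval0 q = 0 -> eval0 (p * q) = 0.
  by move=> q0; rewrite /eval0 mevalM [q.@[_]]q0 mulr0.
(* As both pencils have at least two lines, h_x and g_y have positive degree. *)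
have hx0 : eval0 hx = 0 by apply: eval0_homog hx_homog; rewrite -ltnS prednK ?(ltnW s2_gt1).
have gy0 : eval0 gy = 0 by apply: eval0_homog gy_homog; rewrite -ltnS prednK ?(ltnW s1_gt1).
split; last by rewrite tE; apply: eval0M0; apply: eval0_linear_form.
- apply: n12_eval0; rewrite [_ * a1](_ : _ = - t * n1 * hx); first exact: eval0M0.
  apply: (mulIf z_neq0); apply/eqP; rewrite -subr_eq0 -E1 tE; apply/eqP; ring.
- apply: n12_eval0; rewrite [_ * a2](_ : _ = - t * n2 * gy); first exact: eval0M0.
  apply: (mulIf z_neq0); apply/eqP; rewrite -subr_eq0 -E2 tE; apply/eqP; ring.
Qed.

Theorem exponents_two_pencils : (size s1 <= size s2)%N ->
  exponents (g * h) [:: size s1; size s2; (size s1 + size s2 - 2)%N].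
Proof.
move=> le12; split.
  by rewrite /= le12 /= andbT; lia.
exists (fun j => nth 0 [:: syzygy1; syzygy2; syzygy3] j); split; last first.
  case=> -[|[|[|m]]] //= _.
  - exact: syzygy1_homog.
  - exact: syzygy2_homog.
  - exact: syzygy3_homog.
split.
- case=> -[|[|[|m]]] //= _.
  + exact: syzygy1P.
  + exact: syzygy2P.
  + exact: syzygy3P.
- move=> v /syzygies_generate[a1 [a2 [a3 ->]]].
  exists (fun j => nth 0 [:: a1; a2; a3] j).
  by rewrite (big3 (V := 'rV[S]_3)).
- apply: minimal_of_relations => a.
  rewrite (big3 (V := 'rV[S]_3)) => /relation_eval0[e1 e2 e3].
  case=> -[|[|[|m]]] //= im; [rewrite -[RHS]e1|rewrite -[RHS]e2|rewrite -[RHS]e3];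
    congr (eval0 (a _)); exact: val_inj.
Qed.

End LargePencils.

(** ** A line and a pencil *)

Section SingleLine.
Hypothesis s1_eq1 : size s1 = 1%N.
Hypothesis flat : {in s1, forall i, value i k2 = 0}.

Lemma g_single : exists b, b != 0 /\ g = b *: y.
Proof.
rewrite /g; case: s1 s1_eq1 off_k1 pencil1 flat => [|i [|]] // _ o p f.
exists (value i k1); rewrite o ?mem_head // big_seq1 form_xyz.
by rewrite p ?f ?mem_head // !scale0r add0r addr0.
Qed.

Lemma gy_single : exists b, b != 0 /\ gy = b%:MP /\ gz = 0.
Proof.
have [b [b0 gE]] := g_single; exists b; split=> //.
rewrite /gy /gz gE /partial !derZ !der_basis /= mulr0n scaler0.
by rewrite -mul_mpolyC mulr1.
Qed.

(** Here g = b y, so that y divides the component of v along y, and the quotient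
    t is, up to a constant, the coefficient of the first syzygy. *)
Lemma syzygies_generate_single v : der v (g * h) = 0 ->
  exists a1 a3, v = a1 *: syzygy1 + a3 *: syzygy3.
Proof.
move=> vgh; have [q1 w1] := wedge1_divides vgh.
have [q2 w0] := wedge0_divides vgh.
have [b [b0 gE]] := g_single.
have gyE : gy = b%:MP.
  by rewrite /gy gE /partial derZ der_basis -mul_mpolyC mulr1.
have bb : b^-1%:MP * b%:MP = 1 :> S by rewrite -mpolyCM mulVf.
have [t tE] : divides y (der v y).
  rewrite /wedge1 gE -mul_mpolyC in w1.
  have : divides y (z * der v y).
    by exists (q1 * b%:MP + der v z); rewrite mulrDl -mulrA -w1; ring.
  case/(linear_form_prime (coord_vector_neq0 PQ1 k1)) => //.
  by move/(not_divides_coord PQ1) => /(_ isT).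
have [u2 u2E] := nat_mpoly_unit (ltnW s2_gt1).
have dz := der_z_wedge vgh w1 w0.
exists (u2 * b^-1%:MP * t), (u2 * b^-1%:MP * q2).
have -> : forall (u w : 'rV[S]_3), u + w = u + 0 *: syzygy2 + w.
  by move=> u w; rewrite scale0r addr0.
apply: wedge_generates => //; last first.
  rewrite w0 gyE; transitivity ((u2 * n2) * (b^-1%:MP * b%:MP) * q2 * h).
    by rewrite u2E bb !mul1r.
  by ring.
rewrite w1; congr (_ * _).
have n11 : n1 = 1 by rewrite /n1 s1_eq1.
have q1E : b%:MP * q1 = z * t - der v z.
  apply: (@mulIf _ y); first by rewrite linear_form_eq0 (coord_vector_neq0 PQ1).
  transitivity (q1 * g); first by rewrite gE -mul_mpolyC; ring.
  by rewrite -w1 /wedge1 tE; ring.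
transitivity (u2 * n2 * (b^-1%:MP * b%:MP) * q1); first by rewrite u2E bb !mul1r.
transitivity (u2 * b^-1%:MP * ((n1 + n2) * (b%:MP * q1) - b%:MP * q1)).
  by rewrite n11; ring.
transitivity (u2 * b^-1%:MP *
  ((n1 + n2) * z * t - (n1 + n2) * der v z - b%:MP * q1)).
  by rewrite {1}q1E; ring.
rewrite dz gyE n11; ring.
Qed.

(** The third syzygy has no component along y, as g_z = 0; so a1 = 0. Then a3
    kills h_x and h_z, which by Euler's formula are not both zero. *)
Lemma syzygies_free_single a1 a3 :
  a1 *: syzygy1 + a3 *: syzygy3 = 0 -> a1 = 0 /\ a3 = 0.
Proof.
have [b [b0 [gyE gz0]]] := gy_single.
have gy0 : gy != 0 by rewrite gyE mpolyC_eq0.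
have n20 : n2 != 0 by apply: nat_mpoly_neq0; apply: ltnW.
have gE : g = gy * y.
  have := euler_g; rewrite gz0 mulr0 addr0 => E.
  by rewrite mulrC E /n1 s1_eq1 mul1r.
have y0 : y != 0 by rewrite linear_form_eq0 (coord_vector_neq0 PQ1).
move=> E.
have Ek k d1 d3 : der syzygy1 (coord Q k) = d1 -> der syzygy3 (coord Q k) = d3 ->
    a1 * d1 + a3 * d3 = 0.
  by move=> <- <-; rewrite -!der_scalel -der_addl E der0l.
have a10 : a1 = 0.
  have := Ek k1 _ _ (der_syzygy1 _) (der_syzygy3 _); rewrite gz0 gE /n1 s1_eq1 /= -/y => Ey.
  have /eqP : a1 * (n2 * gy * y) = 0 by rewrite -Ey; ring.
  by rewrite !mulf_eq0 (negbTE n20) (negbTE gy0) (negbTE y0) !orbF => /eqP.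
split=> //; apply/eqP; apply: contraT => a30.
have hz0 : hz = 0.
  have := Ek k0 _ _ (der_syzygy1 _) (der_syzygy3 _); rewrite a10 mul0r add0r /= => Ex.
  have /eqP : a3 * (gy * hz) = 0 by rewrite -Ex; ring.
  by rewrite !mulf_eq0 (negbTE a30) (negbTE gy0) => /eqP.
have hx0 : hx = 0.
  have := Ek k2 _ _ (der_syzygy1 _) (der_syzygy3 _); rewrite a10 mul0r add0r /= => Ez.
  have /eqP : a3 * (gy * hx) = 0 by rewrite -oppr0 -Ez; ring.
  by rewrite !mulf_eq0 (negbTE a30) (negbTE gy0) => /eqP.
have /esym/eqP := euler_h.
by rewrite hx0 hz0 !mulr0 addr0 mulf_eq0 (negbTE n20) (negbTE h_neq0).
Qed.
Theorem exponents_line_pencil :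
  exponents (g * h) [:: 1%N; (size s1 + size s2 - 2)%N].
Proof.
split; first by rewrite /= andbT s1_eq1; lia.
exists (fun j => nth 0 [:: syzygy1; syzygy3] j); split; last first.
  case=> -[|[|m]] //= _.
  - by rewrite -s1_eq1; apply: syzygy1_homog.
  - exact: syzygy3_homog.
have big2 (F : 'I_2 -> 'rV[S]_3) : \sum_k F k = F ord0 + F (lift ord0 ord0).
  by rewrite !big_ord_recl big_ord0 addr0.
split.
- case=> -[|[|m]] //= _.
  + exact: syzygy1P.
  + exact: syzygy3P.
- move=> v /syzygies_generate_single[a1 [a3 ->]].
  exists (fun j => nth 0 [:: a1; a3] j).
  by rewrite big2.
- apply: minimal_of_relations => a; rewrite big2 => /syzygies_free_single[e1 e3].
  case=> -[|[|m]] //= im; apply: etrans (eval0_0 K 3); congr eval0.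
    by rewrite -[RHS]e1; congr a; apply: val_inj.
  by rewrite -[RHS]e3; congr a; apply: val_inj.
Qed.

End SingleLine.

Lemma degree_gh : (msize (g * h)).-1 = (size s1 + size s2)%N.
Proof.
have gh0 : g * h != 0 by rewrite mulf_neq0 ?g_neq0 ?h_neq0.
have hom : g * h \is (size s1 + size s2).-homog by apply: dhomogM; apply: prod_homog.
exact: dhomog_uniq gh0 (dhomog_msize hom) hom.
Qed.

End TwoPencils.

(** * Lines and points of the projective plane *)

Section Geometry.
Variable K : fieldType.
Implicit Types (L : projective_line K) (a : projective_point K).

Lemma on_lineP a L (u : 'rV[K]_3) : u \in val a -> u != 0 ->
  on_line a L = (u \in val L).
Proof.
move=> ua u0; rewrite /on_line memvE; suff /eqP-> : (val a == <[u]>)%VS by [].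
rewrite eq_sym eqEdim -memvE ua dim_vline u0.
by rewrite (eqP (valP a)).
Qed.

Lemma point_vector a : exists2 u : 'rV[K]_3, u \in val a & u != 0.
Proof.
exists (vpick (val a)); first exact: memv_pick.
by rewrite vpick0 -dimv_eq0 (eqP (valP a)).
Qed.

Lemma line_equation_form L l : line_equation L l ->
  l = linear_form (linear_coeffs l) /\
  forall u, (u \in val L) = (dot (linear_coeffs l) u == 0).
Proof.
case=> /homog1_linear_form lE lP; split=> // u.
by rewrite lP [in LHS]lE linear_form_eval.
Qed.

Lemma line_form_neq0 L c : (forall u, (u \in val L) = (dot c u == 0)) -> c != 0.
Proof.
move=> cP; apply: contraTneq (valP L) => c0.
suff -> : val L = fullv by rewrite dimvf.
apply/eqP; rewrite eqEsubv subvf; apply/subvP => u _; rewrite cP c0 /dot.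
by rewrite big1 // => i _; rewrite mxE mul0r.
Qed.

Lemma line_forms_distinct L L' c c' :
  (forall u, (u \in val L) = (dot c u == 0)) ->
  (forall u, (u \in val L') = (dot c' u == 0)) ->
  divides (linear_form c) (linear_form c') -> L = L'.
Proof.
move=> cP c'P [r rE]; apply/val_inj/eqP.
rewrite eqEdim (eqP (valP L)) (eqP (valP L')) leqnn andbT.
apply/subvP => u; rewrite cP c'P -!linear_form_eval rE mevalM => /eqP->.
by rewrite mulr0.
Qed.

Lemma frame_of_free (u0 u1 u2 : 'rV[K]_3) : free [:: u0; u1; u2] ->
  exists P Q : 'M[K]_3, [/\ P *m Q = 1%:M, row ord0 P = u0,
    row (lift ord0 ord0) P = u1 & row (lift ord0 (lift ord0 ord0)) P = u2].
Proof.
move=> fu; pose P : 'M[K]_3 := \matrix_(i < 3) ([:: u0; u1; u2]`_i).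
exists P, (invmx P); split; try by rewrite rowK.
apply: mulmxV; rewrite -row_free_unit -kermx_eq0; apply/rowV0P => w /sub_kermxP.
rewrite mulmx_sum_row => wP.
have /freeP fu' : free (in_tuple [:: u0; u1; u2]) by [].
apply/rowP => i; rewrite mxE; apply: (fu' (w 0)).
by rewrite -[RHS]wP; apply: eq_bigr => j _; rewrite rowK.
Qed.

End Geometry.

(** * Arrangements made of two pencils *)

Section TwoPencilArrangements.
Variables (K : numFieldType) (a1 a2 : projective_point K).
Variables (B1 B2 : {fset projective_line K}) (f : {mpoly K[3]}).
Hypothesis a1B1 : forall L, L \in B1 -> on_line a1 L.
Hypothesis a2B2 : forall L, L \in B2 -> on_line a2 L.
Hypothesis a2NB1 : forall L, L \in B1 -> ~~ on_line a2 L.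
Hypothesis def_f : arrangement_equation (B1 `|` B2)%fset f.

Lemma two_pencil_forms : exists c : projective_line K -> 'rV[K]_3,
  [/\ forall L, L \in enum_fset B1 ++ enum_fset B2 ->
        forall u, (u \in val L) = (dot (c L) u == 0),
      {in enum_fset B1 ++ enum_fset B2, forall L, c L != 0},
      distinct_forms c (enum_fset B1 ++ enum_fset B2)
    & f = \prod_(L <- enum_fset B1) linear_form (c L) *
          \prod_(L <- enum_fset B2) linear_form (c L)].
Proof.
have memU L : (L \in (B1 `|` B2)%fset) = (L \in enum_fset B1 ++ enum_fset B2).
  by rewrite in_fsetU mem_cat.
have uniqU : uniq (enum_fset B1 ++ enum_fset B2).
  rewrite cat_uniq !fset_uniq andbT /=; apply/hasPn => L L2.
  by apply: contraL (a2B2 L2) => /a2NB1.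
have [l [lP fE]] := def_f.
have cP L : L \in (B1 `|` B2)%fset -> l L = linear_form (linear_coeffs (l L)) /\
    forall u, (u \in val L) = (dot (linear_coeffs (l L)) u == 0).
  by move/lP/line_equation_form.
exists (fun L => linear_coeffs (l L)); split.
- by move=> L; rewrite -memU => /cP[].
- by move=> L; rewrite -memU => /cP[_ /line_form_neq0].
- split=> // L L'; rewrite -!memU => /cP[_ LP] /cP[_ L'P] LL'.
  by move/(line_forms_distinct LP L'P)/eqP; apply/negP.
rewrite -big_cat /= fE [LHS]big_seq [RHS]big_seq.
rewrite (perm_big (enum_fset B1 ++ enum_fset B2)) /=; last first.
  by apply: uniq_perm => //; apply: fset_uniq.
by apply: eq_big => L; rewrite -?memU // => /cP[].
Qed.

(** The third basis vector is any vector outside the line joining a1 and a2. *)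
Theorem two_pencil_arrangement :
  (forall L, L \in B2 -> ~~ on_line a1 L) ->
  (2 <= #|` B1|)%N -> (#|` B1| <= #|` B2|)%N ->
  exponents f [:: #|` B1|; #|` B2|; (#|` B1| + #|` B2| - 2)%N] /\
  (msize f).-1 = (#|` B1| + #|` B2|)%N.
Proof.
move=> a1NB2 B1_gt1 leB12.
have [c [cP c0 dc ->]] := two_pencil_forms.
have [u0 u0a u0n] := point_vector a1; have [u1 u1a u1n] := point_vector a2.
have c1P L : L \in enum_fset B1 -> forall u, (u \in val L) = (dot (c L) u == 0).
  by move=> L1; apply: cP; rewrite mem_cat L1.
have c2P L : L \in enum_fset B2 -> forall u, (u \in val L) = (dot (c L) u == 0).
  by move=> L2; apply: cP; rewrite mem_cat L2 orbT.
have [L L1] : exists L, L \in B1.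
  by apply/fset0Pn; rewrite -cardfs_gt0; apply: leq_trans B1_gt1.
have u1_u0 : u1 \notin <[u0]>%VS.
  apply: contra (a2NB1 L1); rewrite (on_lineP _ u1a u1n) => u10.
  move: u1 u10 {u1a u1n}; apply/subvP.
  by rewrite -memvE -(on_lineP _ u0a u0n) a1B1.
have [u2 _ u2_u01] : exists2 u2, u2 \in fullv & u2 \notin <<[:: u1; u0]>>%VS.
  apply/subvPn; apply: contraTN (dim_span [:: u1; u0]) => /dimvS.
  by rewrite dimvf -ltnNge.
have u012 : free [:: u0; u1; u2].
  rewrite (perm_free (Y := rev [:: u0; u1; u2])) 1?perm_sym ?perm_rev //.
  by rewrite !free_cons u2_u01 !span_seq1 u1_u0 span_nil memv0 u0n nil_free.
have [P [Q [PQ1 r0 r1 r2]]] := frame_of_free u012.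
split; last exact: degree_gh.
apply: (exponents_two_pencils PQ1) => //; rewrite ?r0 ?r1; last 2 first.
- by apply: leq_trans leB12.
- by move=> L' L'2; rewrite -(c2P _ L'2) -(on_lineP _ u0a u0n) a1NB2.
- by move=> L' L'1; apply/eqP; rewrite -(c1P _ L'1) -(on_lineP _ u0a u0n) a1B1.
- by move=> L' L'2; apply/eqP; rewrite -(c2P _ L'2) -(on_lineP _ u1a u1n) a2B2.
- by move=> L' L'1; rewrite -(c1P _ L'1) -(on_lineP _ u1a u1n) a2NB1.
- exact: ltnW.
Qed.

(** The point a1 may lie on lines of the second pencil, so it is not used as a
    basis vector: the first and third basis vectors span the single line. *)
Theorem line_pencil_arrangement : #|` B1| = 1%N -> (2 <= #|` B2|)%N ->
  exponents f [:: 1%N; (#|` B1| + #|` B2| - 2)%N] /\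
  (msize f).-1 = (#|` B1| + #|` B2|)%N.
Proof.
move=> B1_1 B2_gt1.
have [c [cP c0 dc ->]] := two_pencil_forms.
have [u1 u1a u1n] := point_vector a2.
have c1P L : L \in enum_fset B1 -> forall u, (u \in val L) = (dot (c L) u == 0).
  by move=> L1; apply: cP; rewrite mem_cat L1.
have c2P L : L \in enum_fset B2 -> forall u, (u \in val L) = (dot (c L) u == 0).
  by move=> L2; apply: cP; rewrite mem_cat L2 orbT.
have /cardfs1P[L B1E] : #|` B1| == 1%N by apply/eqP.
have memB1 L' : (L' \in enum_fset B1) = (L' == L).
  by rewrite -in_fset1 -B1E.
have L1 : L \in enum_fset B1 by rewrite memB1.
have : basis_of (val L) (vbasis (val L)) by apply: vbasisP.
have : size (vbasis (val L)) = 2 by rewrite size_tuple (eqP (valP L)).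
case: (vbasis (val L)) => -[|u0 [|u2 [|]]] //= _ _ /andP[/eqP spanL free02].
have u0L : u0 \in val L by rewrite -[val L]spanL memv_span // mem_head.
have u2L : u2 \in val L by rewrite -[val L]spanL memv_span // !inE eqxx orbT.
have u1L : u1 \notin val L by rewrite -(on_lineP _ u1a u1n) a2NB1.
have u012 : free [:: u0; u1; u2].
  rewrite (perm_free (Y := [:: u1; u0; u2])) ?(free_cons u1) ?spanL ?u1L //.
  by apply/permPl; apply: (perm_catCA [:: u0] [:: u1] [:: u2]).
have [P [Q [PQ1 r0 r1 r2]]] := frame_of_free u012.
have B1L L' : L' \in enum_fset B1 -> L' = L by rewrite memB1 => /eqP.
split; last exact: degree_gh.
apply: (exponents_line_pencil PQ1) => //; rewrite ?r0 ?r1 ?r2.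
- by move=> L' /B1L->; apply/eqP; rewrite -(c1P _ L1).
- by move=> L' L'2; apply/eqP; rewrite -(c2P _ L'2) -(on_lineP _ u1a u1n) a2B2.
- by move=> L' /B1L->; rewrite -(c1P _ L1).
- by rewrite -[size _]/(#|` B1|) B1_1.
- by move=> L' /B1L->; apply/eqP; rewrite -(c1P _ L1).
Qed.

End TwoPencilArrangements.

Local Open Scope fset_scope.

Theorem proposition1p18 (R : realType) (n1 n2 : nat)
    (a1 a2 : projective_point R[i]) (B1 B2 : {fset projective_line R[i]}) (f : {mpoly R[i][3]})
    (cardB1 : #|` B1| = n1) (cardB2 : #|` B2| = n2)
    (a1B1 : forall L : projective_line R[i], L \in B1 -> on_line a1 L)
    (a2B2 : forall L : projective_line R[i], L \in B2 -> on_line a2 L)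
    (a2NB1 : forall L : projective_line R[i], L \in B1 -> ~~ on_line a2 L)
    (a1NB2 : (2 <= n1)%N -> forall L : projective_line R[i], L \in B2 -> ~~ on_line a1 L)
    (n1_gt0 : (1 <= n1)%N) (le_n12 : (n1 <= n2)%N) (n12_gt2 : (n1 + n2 > 2)%N)
    (def_f : arrangement_equation (B1 `|` B2) f) :
  (n1 = 1%N ->
     curve_type f 0 /\ exponents f [:: 1%N; (n1 + n2 - 2)%N]) /\
  ((2 <= n1)%N ->
     curve_type f 1 /\ exponents f [:: n1; n2; (n1 + n2 - 2)%N]).
Proof.
split=> [n11|n1_gt1].
  have n2_gt1 : (2 <= #|` B2|)%N by rewrite cardB2; lia.
  have n11' : #|` B1| = 1%N by rewrite cardB1.
  have [] := line_pencil_arrangement a2B2 a2NB1 def_f n11' n2_gt1.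
  rewrite cardB1 cardB2 => exps deg; split=> //.
  by exists 1%N, (n1 + n2 - 2)%N, [::]; split=> //; rewrite deg; lia.
have n1_gt1' : (2 <= #|` B1|)%N by rewrite cardB1.
have le12 : (#|` B1| <= #|` B2|)%N by rewrite cardB1 cardB2.
have [] := two_pencil_arrangement a1B1 a2B2 a2NB1 def_f (a1NB2 n1_gt1) n1_gt1' le12.
rewrite cardB1 cardB2 => exps deg; split=> //.
by exists n1, n2, [:: (n1 + n2 - 2)%N]; split=> //; rewrite deg; lia.
Qed.
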